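(* Every graph $G$ admits an arithmetic integer additive set-indexer.
   Context: All graphs are simple, finite and have no isolated vertices. $\mathbb{N}_0$ is the set of non-negative integers; all sets considered are finite. For $A,B\subseteq\mathbb{N}_0$, $A+B=\{a+b: a\in A, b\in B\}$. An integer additive set-indexer (IASI) of $G$ is an injective function $f:V(G)\to 2^{\mathbb{N}_0}$ such that the induced function $f^+:E(G)\to 2^{\mathbb{N}_0}$, $f^+(uv)=f(u)+f(v)$, is also injective. An AP-set is a finite set of non-negative integers whose elements, in increasing order, form an arithmetic progression. An arithmetic IASI is an IASI $f$ such that $f(v)$ is an AP-set for every vertex $v$ and $f^+(e)$ is an AP-set for every edge $e$. *)

(* Defs.v *)
From mathcomp Require Import all_boot.
From mathcomp Require Import finmap.

Set Implicit Arguments.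
Unset Strict Implicit.
Unset Printing Implicit Defensive.

Local Open Scope fset_scope.

Record sgraph := SGraph {
  vertex :> finType;
  adj : rel vertex;
  adj_sym : symmetric adj;
  adj_irrefl : irreflexive adj
}.

Definition no_isolated_vertex (G : sgraph) : Prop :=
  forall u : G, exists v : G, adj u v.

Definition sumset (A B : {fset nat}) : {fset nat} :=
  [fset (a + b)%N | a in A, b in B].

(* f^+(uv) = f(u) + f(v) does not depend on the order of the endpoints. *)
Lemma sumsetC (A B : {fset nat}) : sumset A B = sumset B A.
Proof.
by apply/fsetP => x; apply/imfset2P/imfset2P => -[a Aa [b Bb ->]];
  exists b => //; exists a => //; rewrite addnC.
Qed.

(* The edge uv is the unordered pair [set u; v], so the last clause is the
   injectivity of f^+ on the edge set. *)
Definition IASI (G : sgraph) (f : G -> {fset nat}) : Prop :=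
  injective f /\
  forall u v x y : G, adj u v -> adj x y ->
    sumset (f u) (f v) = sumset (f x) (f y) -> [set u; v]%SET = [set x; y]%SET.

Definition arith_progression (s : seq nat) : Prop :=
  exists a d : nat, s = [seq (a + i * d)%N | i <- iota 0 (size s)].

(* A progression has a first term, so the empty set is excluded; singletons
   are (degenerate) progressions. *)
Definition AP_set (A : {fset nat}) : Prop :=
  A != fset0 /\ arith_progression (sort leq (enum_fset A)).

Definition arithmetic_IASI (G : sgraph) (f : G -> {fset nat}) : Prop :=
  [/\ IASI f,
      forall v : G, AP_set (f v) &
      forall u v : G, adj u v -> AP_set (sumset (f u) (f v))].

(* Main.v *)
(** Label the vertex of rank [i] with the progression [2^i, 2^i + 1, 2^i + 2].
    The sum of two progressions with a common difference [d] is again a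
    progression with difference [d], and its first term is the sum of the two
    first terms. An edge label therefore determines [2^i + 2^j], and hence
    [{i, j}] because the powers of two form a Sidon set. *)

Require Import Defs.
From mathcomp Require Import all_boot.
From mathcomp Require Import finmap.

Set Implicit Arguments.
Unset Strict Implicit.
Unset Printing Implicit Defensive.

Local Open Scope fset_scope.
Local Open Scope nat_scope.

Definition Sidon (T : Type) (s : T -> nat) : Prop :=
  forall t u v w : T, s t + s u = s v + s w ->
    t = v /\ u = w \/ t = w /\ u = v.

Lemma Sidon_inj (T : Type) (s : T -> nat) : Sidon s -> injective s.
Proof.
by move=> sidon_s t u eq_s; case: (sidon_s t t u u) => [|[]|[]]; rewrite ?eq_s.
Qed.

Lemma Sidon_comp (T U : Type) (s : T -> nat) (g : U -> T) :
  injective g -> Sidon s -> Sidon (s \o g).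
Proof.
move=> g_inj sidon_s t u v w /sidon_s.
by case=> -[/g_inj -> /g_inj ->]; [left | right].
Qed.

Lemma leq_expnD (p i j k : nat) :
  1 < p -> i < k -> j < k -> p ^ i + p ^ j <= p ^ k.
Proof.
move=> p_gt1; case: k => // k; rewrite !ltnS => le_ik le_jk.
apply: (@leq_trans (p ^ k + p ^ k)); last first.
  by rewrite addnn -mul2n expnS leq_mul2r p_gt1 orbT.
by apply: leq_add; rewrite leq_pexp2l // ltnW.
Qed.

Lemma expnD_leq_max (p i j k l : nat) : 1 < p -> i <= j ->
  p ^ i + p ^ j = p ^ k + p ^ l -> l <= j.
Proof.
move=> p_gt1 le_ij; rewrite leqNgt; apply: contra_eqN => lt_jl.
have lt_il : i < l by apply: leq_ltn_trans lt_jl.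
rewrite ltn_eqF // (leq_ltn_trans (leq_expnD p_gt1 lt_il lt_jl)) //.
by rewrite -[ltnLHS]add0n ltn_add2r expn_gt0 ltnW.
Qed.

Lemma expnD_sorted_inj (p i j k l : nat) : 1 < p -> i <= j -> k <= l ->
  p ^ i + p ^ j = p ^ k + p ^ l -> i = k /\ j = l.
Proof.
move=> p_gt1 le_ij le_kl eq_sum.
have eq_jl : j = l.
  apply/eqP; rewrite eqn_leq (expnD_leq_max p_gt1 le_ij eq_sum) andbT.
  exact: expnD_leq_max p_gt1 le_kl (esym eq_sum).
by move: eq_sum; rewrite eq_jl => /addIn /(expnI p_gt1) ->.
Qed.

Lemma Sidon_expn (p : nat) : 1 < p -> Sidon (expn p).
Proof.
move=> p_gt1 i j k l.
have [le_ij|/ltnW le_ji] := leqP i j; have [le_kl|/ltnW le_lk] := leqP k l.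
- by move=> /(expnD_sorted_inj p_gt1 le_ij le_kl); left.
- by rewrite [RHS]addnC => /(expnD_sorted_inj p_gt1 le_ij le_lk); right.
- by rewrite addnC => /(expnD_sorted_inj p_gt1 le_ji le_kl) [-> ->]; right.
- rewrite addnC [RHS]addnC.
  by move=> /(expnD_sorted_inj p_gt1 le_ji le_lk) [-> ->]; left.
Qed.

(** [n] is the index of the last term, so there are [n + 1] terms. *)
Definition fset_AP (a d n : nat) : {fset nat} :=
  [fset a + i * d | i in iota 0 n.+1].

Lemma fset_APP (a d n x : nat) :
  reflect (exists2 i, i <= n & x = a + i * d) (x \in fset_AP a d n).
Proof.
have mem_iota0 i : (i \in iota 0 n.+1) = (i <= n) by rewrite mem_iota.
apply: (iffP (imfsetP _ _ _ _)) => -[i le_in ->]; exists i => //.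
- by rewrite -mem_iota0.
- by rewrite -mem_iota0 in le_in.
Qed.

Lemma mem_fset_AP_first (a d n : nat) : a \in fset_AP a d n.
Proof. by apply/fset_APP; exists 0; rewrite ?addn0. Qed.

Lemma fset_AP_ge_first (a d n x : nat) : x \in fset_AP a d n -> a <= x.
Proof. by case/fset_APP => i _ ->; apply: leq_addr. Qed.

Lemma fset_AP_first_inj (a b d e m n : nat) :
  fset_AP a d m = fset_AP b e n -> a = b.
Proof.
move=> eq_ab; apply/eqP; rewrite eqn_leq; apply/andP; split.
- by apply: (@fset_AP_ge_first a d m); rewrite eq_ab mem_fset_AP_first.
- by apply: (@fset_AP_ge_first b e n); rewrite -eq_ab mem_fset_AP_first.
Qed.

Lemma sumset_fset_AP (a b d m n : nat) :
  sumset (fset_AP a d m) (fset_AP b d n) = fset_AP (a + b) d (m + n).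
Proof.
apply/fsetP => x; apply/imfset2P/fset_APP => /=.
- move=> [_ /fset_APP[i le_im ->] [_ /fset_APP[j le_jn ->] ->]].
  by exists (i + j); rewrite ?leq_add // mulnDl addnACA.
- move=> [k le_k ->]; exists (a + minn k m * d).
    by apply/fset_APP; exists (minn k m); rewrite ?geq_minr.
  exists (b + (k - m) * d).
    by apply/fset_APP; exists (k - m); rewrite ?leq_subLR.
  by rewrite addnACA -mulnDl minnE subnK ?leq_subr.
Qed.

Lemma sort_fset_AP (a d n : nat) : 0 < d ->
  sort leq (enum_fset (fset_AP a d n)) = [seq a + i * d | i <- iota 0 n.+1].
Proof.
move=> d_gt0; apply: (irr_sorted_eq ltn_trans ltnn).
- by rewrite ltn_sorted_uniq_leq sort_uniq fset_uniq (sort_sorted leq_total).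
- apply: (homo_sorted _ _ (iota_ltn_sorted 0 n.+1)) => i j lt_ij.
  by rewrite ltn_add2l ltn_pmul2r.
- by move=> x; rewrite mem_sort; apply/imfsetP/mapP.
Qed.

Lemma AP_set_fset_AP (a d n : nat) : 0 < d -> AP_set (fset_AP a d n).
Proof.
move=> d_gt0; split; first by apply/fset0Pn; exists a; apply: mem_fset_AP_first.
by exists a, d; rewrite sort_fset_AP // size_map size_iota.
Qed.

Lemma arithmetic_IASI_fset_AP (G : sgraph) (s n : G -> nat) (d : nat) :
  0 < d -> Sidon s -> arithmetic_IASI (fun v => fset_AP (s v) d (n v)).
Proof.
move=> d_gt0 sidon_s; split.
- split=> [u v /fset_AP_first_inj /(Sidon_inj sidon_s) //|u v x y _ _].
  rewrite !sumset_fset_AP => /fset_AP_first_inj /sidon_s.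
  by case=> -[-> ->] //; rewrite setUC.
- by move=> v; apply: AP_set_fset_AP.
- by move=> u v _; rewrite sumset_fset_AP; apply: AP_set_fset_AP.
Qed.

Theorem theorem3p1 (G : sgraph) (hG : no_isolated_vertex G) :
  exists f : G -> {fset nat}, arithmetic_IASI f.
Proof.
have rank_inj : injective (fun v : G => enum_rank v : nat).
  by move=> u v /ord_inj /enum_rank_inj.
exists (fun v => fset_AP (2 ^ enum_rank v) 1 2).
apply: arithmetic_IASI_fset_AP => //.
exact: Sidon_comp rank_inj (Sidon_expn (ltnSn 1)).
Qed.
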